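(* Let $(X,\mathscr A,\mu)$ be a $\sigma$-finite measure space, $w\colon X\to\mathbb C$ an $\mathscr A$-measurable function and $\phi\colon X\to X$ an $\mathscr A$-measurable transformation such that $\mu_w\circ\phi^{-1}\ll\mu$. Let $\alpha\in(0,1]$. If $w\neq0$ a.e. $[\mu]$ and $\mathsf h_{\phi^k,w^{[k]}}<\infty$ a.e. $[\mu]$ for some integer $k\geqslant2$, where $w^{[k]}:=\prod_{j=0}^{k-1}w\circ\phi^j$, then $C_{\phi,w_\alpha}$ is densely defined.
   Context: $\overline{\mathbb R}_+=[0,\infty]$. A transformation $\phi\colon X\to X$ is $\mathscr A$-measurable if $\phi^{-1}(\Delta)\in\mathscr A$ for all $\Delta\in\mathscr A$; $\phi^j$ is the $j$-fold composition of $\phi$ with itself ($\phi^0$ is the identity). For an $\mathscr A$-measurable $u\colon X\to\mathbb C$, $\mu_u(\Delta)=\int_\Delta|u|^2\,\mathrm d\mu$; for an $\mathscr A$-measurable transformation $\psi$, $\mu_u\circ\psi^{-1}(\Delta)=\mu_u(\psi^{-1}(\Delta))$, $\Delta\in\mathscr A$. If $\mu_u\circ\psi^{-1}\ll\mu$, then $\mathsf h_{\psi,u}\colon X\to\overline{\mathbb R}_+$ is the ($\mu$-a.e. unique) Radon–Nikodym derivative: $\mu_u\circ\psi^{-1}(\Delta)=\int_\Delta\mathsf h_{\psi,u}\,\mathrm d\mu$, $\Delta\in\mathscr A$, and the weighted composition operator $C_{\psi,u}$ in $L^2(\mu)$ is defined by $\mathcal D(C_{\psi,u})=\{f\in L^2(\mu)\colon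 u\cdot(f\circ\psi)\in L^2(\mu)\}$, $C_{\psi,u}f=u\cdot(f\circ\psi)$; it is closed, and densely defined iff $\mathsf h_{\psi,u}<\infty$ a.e. $[\mu]$. If $\mu_w\circ\phi^{-1}\ll\mu$, then $\mu_{w^{[k]}}\circ(\phi^k)^{-1}\ll\mu$, so $\mathsf h_{\phi^k,w^{[k]}}$ is defined. For $\alpha\in(0,1]$ and densely defined $C_{\phi,w}$, $w_\alpha\colon X\to\mathbb C$ is an $\mathscr A$-measurable function with $w_\alpha=w\cdot\big(\frac{\mathsf h_{\phi,w}}{\mathsf h_{\phi,w}\circ\phi}\big)^{\alpha/2}$ a.e. $[\mu]$ (one has $\mathsf h_{\phi,w}\circ\phi>0$ a.e. $[\mu_w]$; $w_\alpha=0$ a.e. on $\{w=0\}$). Moreover $\mu_{w_\alpha}\circ\phi^{-1}\ll\mu$, so $C_{\phi,w_\alpha}$ is defined. *)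

(* Defs.v *)
(* MathComp-Analysis, with complex numbers R[i] from mathcomp-real-closed. *)
From HB Require Import structures.
From mathcomp Require Import all_boot all_order all_algebra.
From mathcomp Require Import complex.
From mathcomp Require Import all_classical all_reals all_analysis.
From mathcomp Require Import measurable_realfun.

Set Implicit Arguments.
Unset Strict Implicit.
Unset Printing Implicit Defensive.

Import Order.TTheory GRing.Theory Num.Theory.
Import numFieldNormedType.Exports.

Local Open Scope classical_set_scope.
Local Open Scope ring_scope.

Section WeightedCompositionOperators.
Context {d : measure_display} {X : measurableType d} {R : realType}.
Variable mu : {measure set X -> \bar R}.
Implicit Types (f g u w wa : X -> R[i]) (phi psi : X -> X) (h : X -> \bar R).

(* The library has no sigma-algebra on R[i]; Borel measurability of a
   complex function is that of its real and imaginary parts. *)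
Definition cmeasurable f : Prop :=
  measurable_fun [set: X] (fun x => complex.Re (f x)) /\
  measurable_fun [set: X] (fun x => complex.Im (f x)).

Definition cmod (z : R[i]) : R := ComplexField.Normc.normc z.

(* mu_u(Delta) = \int_Delta |u|^2 dmu *)
Definition weighted_measure u (A : set X) : \bar R :=
  (\int[mu]_(x in A) ((cmod (u x) ^+ 2)%R)%:E)%E.

(* L^2(mu) is handled through representatives: its elements are measurable
   functions rather than classes modulo a.e. equality, and L2norm is the
   corresponding seminorm. *)
Definition L2norm f : \bar R := Lnorm mu 2%:E (fun x => (cmod (f x))%:E).

Definition L2 : set (X -> R[i]) :=
  [set f | cmeasurable f /\ (L2norm f < +oo)%E].

Definition L2dense (D : set (X -> R[i])) : Prop :=
  forall f, L2 f -> forall e : R, 0 < e ->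
    exists2 g, D g & (L2norm (fun x => f x - g x)%R < e%:E)%E.

Definition wco_abs_cont psi u : Prop :=
  pushforward (weighted_measure u) psi `<< mu.

Definition wco psi u f : X -> R[i] := fun x => u x * f (psi x).

Definition wco_domain psi u : set (X -> R[i]) :=
  L2 `&` [set f | L2 (wco psi u f)].

(* Absolute continuity is what makes C_{psi,u} well defined on classes modulo
   a.e. equality (the domain and wco then respect a.e. equality), so it is part
   of the assertion that C_{psi,u} is a densely defined operator. *)
Definition wco_densely_defined psi u : Prop :=
  wco_abs_cont psi u /\ L2dense (wco_domain psi u).

(* h is (a version of) h_{psi,u}. It is extended-real valued since
   mu_u o psi^-1 need not be sigma-finite, which is why the library's
   Radon-Nikodym derivative of a finite charge does not apply. *)
Definition is_RN_derivative psi u h : Prop :=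
  [/\ measurable_fun [set: X] h,
      forall x, (0 <= h x)%E &
      forall A, measurable A ->
        pushforward (weighted_measure u) psi A = (\int[mu]_(x in A) h x)%E].

(* w^[k] = \prod_(j < k) w o phi^j *)
Definition weight_iter phi w (k : nat) : X -> R[i] :=
  fun x => \prod_(j < k) w (iter j phi x).

(* wa is (a version of) w_alpha, where h is h_{phi,w}. When C_{phi,w} is densely
   defined, h and h o phi are finite and h o phi is positive a.e. on {w != 0},
   so fine and the division by zero convention only matter on a null set or
   where w = 0; the right-hand side vanishes in the latter case. *)
Definition is_weight_alpha phi w h (alpha : R) wa : Prop :=
  cmeasurable wa /\
  \forall x \ae mu,
    wa x = w x * real_complex R ((fine (h x) / fine (h (phi x))) `^ (alpha / 2)).

End WeightedCompositionOperators.

(* Main.v *)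
(* Say that nu is sigma-finite modulo mu-null sets when there are increasing sets
   A_n covering mu-almost every point with nu(A_n) finite. For
   nu = mu_u o psi^-1 this is finiteness of h_{psi,u}, and it yields density of
   the domain: truncate f to A_n and to {|f|^2 <= n}. With
   nu_j = mu_{w^[j]} o (phi^j)^-1 and B_n = phi^-1(A_n) /\ {n |w|^2 >= 1} one has
   nu_j(B_n) <= n nu_{j+1}(A_n), and the B_n cover since w != 0, so finiteness
   descends from k to 2 and 1. Finally (h / h o phi)^alpha <= 1 + h / h o phi,
   so on phi^-1{h >= 1/n} the weight |w_alpha|^2 is at most |w|^2 + n |w|^2 h,
   whose integral over phi^-1(A) is nu_1(A) + n nu_2(A). *)
Require Import Defs.
From HB Require Import structures.
From mathcomp Require Import all_boot all_order all_algebra.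
From mathcomp Require Import complex.
From mathcomp Require Import all_classical all_reals all_analysis.
From mathcomp Require Import measurable_realfun.
From mathcomp Require Import ring lra.

Set Implicit Arguments.
Unset Strict Implicit.
Unset Printing Implicit Defensive.

Import Order.TTheory GRing.Theory Num.Theory.
Import numFieldNormedType.Exports.

Local Open Scope classical_set_scope.
Local Open Scope ring_scope.

(** * Integration against a measure given by a density *)

Section Density.
Local Open Scope ereal_scope.
Context {d : measure_display} {X : measurableType d} {R : realType}.
Variable mu : {measure set X -> \bar R}.

(** The proofs [mg] and [g0] are arguments so that the measure structure declared below can be
    inferred from the term alone. *)
Definition density_measure (g : X -> \bar R) (mg : measurable_fun setT g)
    (g0 : forall x, 0 <= g x) (A : set X) : \bar R :=
  \int[mu]_(x in A) g x.

Section Instances.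
Variables (g : X -> \bar R) (mg : measurable_fun setT g).
Hypothesis g0 : forall x, 0 <= g x.

Let density0 : density_measure mg g0 set0 = 0.
Proof. by rewrite /density_measure integral_set0. Qed.

Let density_ge0 A : 0 <= density_measure mg g0 A.
Proof. by apply: integral_ge0 => x _; exact: g0. Qed.

Let density_sigma_additive : semi_sigma_additive (density_measure mg g0).
Proof. exact: semi_sigma_additive_nng_induced. Qed.

HB.instance Definition _ := isMeasure.Build d X R (density_measure mg g0)
  density0 density_ge0 density_sigma_additive.
End Instances.

(** Multiplication by +oo is not continuous at 0, but monotonicity rescues the limit: [a] is the
    supremum of the [u n], so either all of them vanish or they are eventually positive and the
    product is eventually constant at +oo. *)
Lemma cvg_muleZr_ge0_nd (u : nat -> R) (a b : \bar R) :
  (forall n, (0 <= u n)%R) -> {homo u : n m / (n <= m)%N >-> (n <= m)%R} ->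
  0 <= b -> (u n)%:E @[n --> \oo] --> a -> (u n)%:E * b @[n --> \oo] --> a * b.
Proof.
move=> u0 ndu b0 ua; have [bfin|] := boolP (b \is a fin_num).
  exact: cvgeZr.
rewrite ge0_fin_numE// -leNgt leye_eq => /eqP ->.
have a_sup : a = ereal_sup (range (EFin \o u)).
  rewrite -(cvg_lim _ ua)//; apply/cvg_lim => //.
  by apply: ereal_nondecreasing_cvgn => n m nm /=; rewrite lee_fin ndu.
have ua_le n : (u n)%:E <= a by rewrite a_sup; apply: ereal_sup_ubound; exists n.
have : 0 <= a by apply: le_trans (ua_le 0%N); rewrite lee_fin.
rewrite le_eqVlt => /orP[/eqP a0|a0].
  rewrite -a0 mul0e; apply: cvg_near_cst; apply: nearW => n.
  suff -> : u n = 0%R by rewrite mul0e.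
  by apply/eqP; rewrite eq_le u0 andbT -lee_fin (le_trans (ua_le n))// -a0.
rewrite gt0_muley//; apply: cvg_near_cst.
have [N uN] : exists N, (0 < u N)%R.
  apply/not_existsP => H; move: a0; rewrite ltNge => /negP; apply.
  rewrite a_sup; apply: ge_ereal_sup => _ [n _ <-] /=; rewrite lee_fin leNgt.
  by apply/negP/H.
exists N => // n /= Nn; rewrite gt0_muley// lte_fin.
by apply: lt_le_trans uN _; exact: ndu.
Qed.

Import HBNNSimple.

(** Both sides are limits along an increasing sequence of simple functions approximating [f], and on
    indicators the identity is the definition of [density_measure]. The density may take the value
    +oo. *)
Lemma ge0_integral_density (g : X -> \bar R) (mg : measurable_fun setT g)
    (g0 : forall x, 0 <= g x) (f : X -> \bar R) :
  measurable_fun setT f -> (forall x, 0 <= f x) ->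
  \int[density_measure mg g0]_x f x = \int[mu]_x (f x * g x).
Proof.
move=> mf f0; pose s := nnsfun_approx (@measurableT _ X) mf.
have s_f x : (s n x)%:E @[n --> \oo] --> f x by exact: cvg_nnsfun_approx.
have nds x : {homo (fun n => s n x) : n m / (n <= m)%N >-> (n <= m)%R}.
  by move=> n m nm; exact/lefP/nd_nnsfun_approx.
have ms n : measurable_fun setT (EFin \o s n) by exact/measurable_EFinP.
have -> : \int[mu]_x (f x * g x) =
    lim (\int[mu]_x ((s n x)%:E * g x) @[n --> \oo]).
  rewrite -monotone_convergence//.
  - apply: eq_integral => x _; apply/esym/cvg_lim => //.
    exact: cvg_muleZr_ge0_nd.
  - by move=> n; apply: emeasurable_funM => //; exact: ms.
  - by move=> n x _; rewrite mule_ge0 ?lee_fin.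
  - by move=> x _ n m nm; rewrite lee_wpmul2r ?lee_fin ?nds.
rewrite (nd_ge0_integral_lim _ f0 nds)//.
congr (limn _); apply/funext => n.
rewrite /= sintegralE.
(* Split the simple function over its finitely many values, so that the integral becomes a sum over
   level sets. *)
have sE x : (s n x)%:E * g x =
    \sum_(y \in range (s n)) ((y * \1_(s n @^-1` [set y]) x)%:E * g x).
  rewrite -ge0_mule_fsuml => [|y]; last exact: nnfun_muleindic_ge0.
  by rewrite fsumEFin// -fimfunE.
under [RHS]eq_integral do rewrite sE.
rewrite ge0_integral_fsum//; first last.
  by move=> y x _; rewrite mule_ge0// nnfun_muleindic_ge0.
  by move=> y; apply: emeasurable_funM => //; exact/measurable_EFinP/measurable_funM.
apply: eq_fsbigr => y /set_mem [x _ sxy].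
under [RHS]eq_integral do rewrite EFinM -muleA.
rewrite ge0_integralZl//; last 3 first.
- by apply: emeasurable_funM => //; exact/measurable_EFinP.
- by move=> z _; rewrite mule_ge0 ?lee_fin.
- by rewrite lee_fin -sxy.
congr (_ * _).
rewrite [LHS](_ : _ = \int[mu]_(z in s n @^-1` [set y]) g z)//.
rewrite integral_mkcond epatch_indic.
by apply: eq_integral => z _ /=; rewrite muleC.
Qed.
End Density.

(** * The complex modulus *)

Section ComplexModulus.
Context {R : realType}.
Implicit Types z : R[i].

Lemma cmod_ge0 z : 0 <= cmod z.
Proof. by case: z => a b; exact: sqrtr_ge0. Qed.

Lemma cmodM z1 z2 : cmod (z1 * z2) = cmod z1 * cmod z2.
Proof. exact: ComplexField.Normc.normcM. Qed.

Lemma cmod_sqr z : cmod z ^+ 2 = complex.Re z ^+ 2 + complex.Im z ^+ 2.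
Proof. by case: z => a b; rewrite /cmod sqr_sqrtr// addr_ge0 ?sqr_ge0. Qed.

Lemma cmod_real_sqr (r : R) : cmod (real_complex R r) ^+ 2 = r ^+ 2.
Proof. by rewrite cmod_sqr/= expr0n addr0. Qed.

Lemma cmod_eq0 z : (cmod z == 0) = (z == 0).
Proof.
apply/eqP/eqP => [|->]; first exact: ComplexField.Normc.eq0_normc.
exact: ComplexField.Normc.normc0.
Qed.

End ComplexModulus.

(** * Measurability of complex functions and of iterated weights *)

Section ComplexMeasurable.
Context {d : measure_display} {X : measurableType d} {R : realType}.
Implicit Types f g : X -> R[i].

Lemma cmeasurableM f g :
  cmeasurable f -> cmeasurable g -> cmeasurable (fun x => f x * g x).
Proof.
move=> [fr fi] [gr gi]; split.
  rewrite (_ : (fun x => _) = (fun x => complex.Re (f x) * complex.Re (g x) -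
      complex.Im (f x) * complex.Im (g x))).
    by apply: measurable_funB; apply: measurable_funM.
  by apply/funext => x; case: (f x) => ? ?; case: (g x).
rewrite (_ : (fun x => _) = (fun x => complex.Re (f x) * complex.Im (g x) +
    complex.Im (f x) * complex.Re (g x))).
  by apply: measurable_funD; apply: measurable_funM.
by apply/funext => x; case: (f x) => ? ?; case: (g x).
Qed.

Lemma cmeasurable_real (r : X -> R) :
  measurable_fun setT r -> cmeasurable (fun x => real_complex R (r x)).
Proof. by move=> mr; split. Qed.

Lemma cmeasurable_comp f (psi : X -> X) :
  cmeasurable f -> measurable_fun setT psi -> cmeasurable (f \o psi).
Proof. by move=> [fr fi] mpsi; split; [exact: measurableT_comp fr mpsi|exact: measurableT_comp fi mpsi]. Qed.

Lemma measurable_cmod_sqr f :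
  cmeasurable f -> measurable_fun setT (fun x => (cmod (f x) ^+ 2)%:E).
Proof.
move=> [fr fi]; apply/measurable_EFinP; under eq_fun do rewrite cmod_sqr.
by apply: measurable_funD; exact: measurable_funX.
Qed.

Lemma measurable_fun_iter (phi : X -> X) (k : nat) :
  measurable_fun setT phi -> measurable_fun setT (iter k phi).
Proof.
move=> mphi; elim: k => [|k IHk]; first exact: measurable_id.
exact: measurableT_comp mphi IHk.
Qed.

Lemma cmeasurable_weight_iter (phi : X -> X) (w : X -> R[i]) (k : nat) :
  cmeasurable w -> measurable_fun setT phi ->
  cmeasurable (weight_iter phi w k).
Proof.
move=> mw mphi; elim: k => [|k IHk].
  rewrite /weight_iter; under eq_fun do rewrite big_ord0.
  by split; exact: measurable_cst.
rewrite /weight_iter; under eq_fun do rewrite big_ord_recr/=.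
by apply: cmeasurableM => //; apply: cmeasurable_comp => //; exact: measurable_fun_iter.
Qed.

End ComplexMeasurable.

(** * Weighted measures, the L^2 seminorm and null sets *)

Section WeightedComposition.
Context {d : measure_display} {X : measurableType d} {R : realType}.
Variable mu : {measure set X -> \bar R}.
Implicit Types (u f : X -> R[i]) (psi : X -> X).

Lemma le_weighted_measure (c : R) u f (A B : set X) : 0 <= c ->
  cmeasurable u -> cmeasurable f -> measurable A -> measurable B ->
  A `<=` B -> (forall x, A x -> cmod (u x) ^+ 2 <= c * cmod (f x) ^+ 2) ->
  (weighted_measure mu u A <= c%:E * weighted_measure mu f B)%E.
Proof.
move=> c0 mu_ mf mA mB AB uf.
have mf2 D : measurable_fun D (fun x => (cmod (f x) ^+ 2)%:E).
  exact/measurable_funTS/measurable_cmod_sqr.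
apply: (@le_trans _ _ (c%:E * weighted_measure mu f A)%E).
  rewrite -ge0_integralZl//; last by move=> x _; rewrite lee_fin sqr_ge0.
  apply: ge0_le_integral => //.
  - by move=> x _; rewrite lee_fin sqr_ge0.
  - exact/measurable_funTS/measurable_cmod_sqr.
  - exact: measurable_funeM.
apply: lee_wpmul2l => //; apply: ge0_subset_integral => //.
by move=> x _; rewrite lee_fin sqr_ge0.
Qed.

(** Turns norm estimates into estimates of the integral of |f|^2. *)
Lemma poweR_L2norm f : (L2norm mu f `^ 2 = weighted_measure mu f setT)%E.
Proof.
rewrite /L2norm poweR_Lnorm//; apply: eq_integral => x _.
by rewrite /= ger0_norm ?cmod_ge0// powR_mulrn ?cmod_ge0.
Qed.

Lemma L2norm_lty f :
  (L2norm mu f < +oo)%E = (weighted_measure mu f setT < +oo)%E.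
Proof.
rewrite -poweR_L2norm; apply/idP/idP; first exact: poweR_lty.
by apply: lty_poweRy.
Qed.

Lemma L2norm_lt f (e : R) : 0 < e ->
  (weighted_measure mu f setT < (e ^+ 2)%:E)%E -> (L2norm mu f < e%:E)%E.
Proof.
move=> e0; rewrite !ltNge; apply: contra => eL; rewrite -poweR_L2norm.
rewrite -powR_mulrn; last exact: ltW.
rewrite -poweR_EFin; apply: gt0_ler_poweR => //.
- by rewrite in_itv/= leey lee_fin ltW.
- by rewrite in_itv/= leey andbT (le_trans _ eL)// lee_fin ltW.
Qed.

Lemma wco_abs_contP psi u :
  (forall A, measurable A -> mu A = 0%E ->
    weighted_measure mu u (psi @^-1` A) = 0%E) -> wco_abs_cont mu psi u.
Proof. by move=> H N N0 A mA AN; exact/H/N0. Qed.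

Lemma weighted_measure0 psi u (A : set X) : wco_abs_cont mu psi u ->
  measurable A -> mu A = 0%E -> weighted_measure mu u (psi @^-1` A) = 0%E.
Proof. by move=> + mA A0 => /(_ A) H; apply: H => //; apply/measure0_null_setP. Qed.

(* For an almost everywhere nonzero weight, mu_u and mu have the same null
   sets, so psi is nonsingular for mu itself. *)
Lemma ae_preimage psi u (P : set X) :
  cmeasurable u -> measurable_fun setT psi -> wco_abs_cont mu psi u ->
  (\forall x \ae mu, u x != 0) ->
  (\forall x \ae mu, P x) -> \forall x \ae mu, P (psi x).
Proof.
move=> mu_ mpsi acu u0 [N [mN N0 PN]].
have mpN : measurable (psi @^-1` N) by rewrite -[X in measurable X]setTI; exact: mpsi.
have : ae_eq mu (psi @^-1` N) (fun x => (cmod (u x) ^+ 2)%:E) (cst 0%E).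
  apply/ae_eq_integral_abs => //; first exact/measurable_funTS/measurable_cmod_sqr.
  rewrite -[RHS](weighted_measure0 acu mN N0); apply: eq_integral => x _.
  by rewrite gee0_abs// lee_fin sqr_ge0.
move: u0; apply: filterS2 => x ux0 /= H.
apply: contrapT => nP.
have /H[] : N (psi x) by apply: PN.
by move/eqP; rewrite expf_eq0/= cmod_eq0 (negbTE ux0).
Qed.

End WeightedComposition.

(** * Sigma-finiteness modulo null sets implies a dense domain *)

Section SigmaFinite.
Context {d : measure_display} {X : measurableType d} {R : realType}.
Variable mu : {measure set X -> \bar R}.
Implicit Types (u f : X -> R[i]) (psi : X -> X) (nu : set X -> \bar R).

(* When nu has a mu-density, this says that the density is finite mu-almost
   everywhere, provided that mu is sigma-finite; no density is needed to
   state it. *)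
Definition ae_sigma_finite nu : Prop :=
  exists A : nat -> set X,
    [/\ {homo A : n m / (n <= m)%N >-> n `<=` m},
        forall n, measurable (A n),
        forall n, (nu (A n) < +oo)%E &
        \forall x \ae mu, exists n, A n x].

Lemma L2_restrict f (C : set X) :
  L2 mu f -> measurable C -> L2 mu (fun x => f x * real_complex R (\1_C x)).
Proof.
move=> [mf f2] mC.
have mfC : cmeasurable (fun x => f x * real_complex R (\1_C x)).
  by apply: cmeasurableM => //; apply: cmeasurable_real; exact: measurable_indic.
split=> //; move: f2; rewrite !L2norm_lty; apply: le_lt_trans.
rewrite -[leRHS]mul1e; apply: le_weighted_measure => // x _.
by rewrite cmodM exprMn cmod_real_sqr mulrC ler_wpM2r ?sqr_ge0.
Qed.

Lemma cmod_sqr_restrictC f (C : set X) x :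
  cmod (f x - f x * real_complex R (\1_C x)) ^+ 2 =
  cmod (f x) ^+ 2 * (1 - \1_C x).
Proof.
rewrite indicE; case: (_ \in _); first by rewrite mulr1 !subrr mulr0 cmod_sqr expr0n addr0.
by rewrite mulr0 !subr0 mulr1.
Qed.

(** The squared error is the integral of |f|^2 off [C n]. It tends to 0 by dominated convergence
    with majorant |f|^2, since almost every point lies in [C n] for all large n. *)
Lemma L2_restrict_dense f (C : nat -> set X) (e : R) :
  L2 mu f -> {homo C : n m / (n <= m)%N >-> n `<=` m} ->
  (forall n, measurable (C n)) -> (\forall x \ae mu, exists n, C n x) -> 0 < e ->
  exists n, (L2norm mu (fun x => f x - f x * real_complex R (\1_(C n) x))%R < e%:E)%E.
Proof.
move=> [mf f2] ndC mC covC e0.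
pose F n x : \bar R := (cmod (f x) ^+ 2 * (1 - \1_(C n) x))%:E.
have WF n : weighted_measure mu (fun x => f x - f x * real_complex R (\1_(C n) x))
    setT = (\int[mu]_x F n x)%E.
  by apply: eq_integral => x _; rewrite cmod_sqr_restrictC.
have mF n : measurable_fun setT (F n).
  apply/measurable_EFinP/measurable_funM; first exact/measurable_EFinP/measurable_cmod_sqr.
  by apply: measurable_funB => //; exact: measurable_indic.
have F0 : (\int[mu]_x F n x @[n --> \oo] --> \int[mu]_x (cst 0 x : \bar R))%E.
  have [] := @dominated_convergence _ _ _ mu setT measurableT F (cst 0%E)
    (fun x => (cmod (f x) ^+ 2)%:E) mF => //.
  - apply: filterS covC => x [N CNx] _; apply: cvg_near_cst.
    exists N => // n /= Nn; rewrite /F indicE mem_set ?subrr ?mulr0//.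
    exact: ndC CNx.
  - apply/integrableP; split; first exact: measurable_cmod_sqr.
    under eq_integral do rewrite gee0_abs ?lee_fin ?sqr_ge0//.
    by rewrite -/(weighted_measure mu f setT) -L2norm_lty.
  - apply: aeW => x n _; rewrite /F gee0_abs lee_fin.
      rewrite ler_piMr ?sqr_ge0// indicE; case: (_ \in _); lra.
    rewrite mulr_ge0 ?sqr_ge0// indicE; case: (_ \in _); lra.
rewrite integral0 in F0.
have e20 : (0 < (e ^+ 2)%:E :> \bar R)%E by rewrite lte_fin exprn_gt0.
have [N _ /(_ N (leqnn N)) HN] := F0 _ (open_ereal_lt' e20).
by exists N; apply: L2norm_lt => //; rewrite WF.
Qed.

Lemma ae_sigma_finite_densely_defined psi u :
  cmeasurable u -> measurable_fun setT psi -> wco_abs_cont mu psi u ->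
  ae_sigma_finite (pushforward (weighted_measure mu u) psi) ->
  wco_densely_defined mu psi u.
Proof.
move=> mu_ mpsi acu [A [ndA mA Afin covA]]; split=> // f f2 e e0.
have [mf _] := f2.
have mf2 := measurable_cmod_sqr mf.
pose C n := A n `&` [set x | (cmod (f x) ^+ 2)%:E <= n%:R%:E]%E.
have mC n : measurable (C n).
  apply: measurableI => //; rewrite -[X in measurable X]setTI.
  exact: emeasurable_fun_infty_c.
have ndC : {homo C : n m / (n <= m)%N >-> n `<=` m}.
  move=> n m nm x [/(ndA _ _ nm) Ax /= fx]; split => //=.
  by rewrite (le_trans fx)// lee_fin ler_nat.
have covC : \forall x \ae mu, exists n, C n x.
  apply: filterS covA => x [n Ax].
  (* The successor of the integer part bounds |f x|^2; monotonicity of [A] allows passing to the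
     maximum. *)
  exists (maxn n (Num.truncn (cmod (f x) ^+ 2)).+1); split.
    by apply: ndA Ax; exact: leq_maxl.
  rewrite /= lee_fin; apply: (@le_trans _ _ (Num.truncn (cmod (f x) ^+ 2)).+1%:R).
    by rewrite ltW// truncnS_gt.
  by rewrite ler_nat leq_maxr.
have [n fn] := L2_restrict_dense f2 ndC mC covC e0.
exists (fun x => f x * real_complex R (\1_(C n) x)) => //.
have L2g := L2_restrict f2 (mC n).
have [mg _] := L2g.
split=> //; have mwco := cmeasurableM mu_ (cmeasurable_comp mg mpsi).
split=> //; rewrite L2norm_lty.
have mpA : measurable (psi @^-1` A n) by rewrite -[X in measurable X]setTI; exact: mpsi.
apply: (@le_lt_trans _ _ (n%:R%:E * weighted_measure mu u (psi @^-1` A n))%E); last first.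
  rewrite lte_mul_pinfty ?lee_fin//; exact: Afin.
rewrite -ge0_integralZl//; last 2 first.
- exact/measurable_funTS/measurable_cmod_sqr.
- by move=> x _; rewrite lee_fin sqr_ge0.
rewrite integral_mkcond; apply: ge0_le_integral => //.
- by move=> x _; rewrite lee_fin sqr_ge0.
- exact: measurable_cmod_sqr.
- apply/(measurable_restrictT _ mpA); apply: measurable_funeM.
  exact/measurable_funTS/measurable_cmod_sqr.
move=> x _; rewrite /wco !cmodM !exprMn cmod_real_sqr patchE.
case: ifPn => [|xA]; last first.
  rewrite indicE memNset ?expr0n ?mulr0// => -[Ax _].
  by move/negP: xA; apply; rewrite inE.
rewrite inE => /= Ax; rewrite -EFinM lee_fin mulrC ler_wpM2r ?sqr_ge0//.
rewrite indicE; case: (boolP (_ \in _)) => [|_]; last by rewrite expr0n mulr0.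
by rewrite inE expr1n mulr1 => -[_]; rewrite /= lee_fin.
Qed.

End SigmaFinite.

(** * Radon-Nikodym derivatives and change of variables *)

Section RadonNikodym.
Context {d : measure_display} {X : measurableType d} {R : realType}.

(** If the sets [S n] exhaust X with finite measure, then on the part of [S n] where h <= n the
    integral of h is at most n mu(S n). This is where sigma-finiteness of mu enters. *)
Lemma RN_ae_sigma_finite (mu : {sigma_finite_measure set X -> \bar R})
    (psi : X -> X) (u : X -> R[i]) (h : X -> \bar R) :
  is_RN_derivative mu psi u h -> (\forall x \ae mu, (h x < +oo)%E) ->
  ae_sigma_finite mu (pushforward (weighted_measure mu u) psi).
Proof.
move=> [mh h0 hE] hfin.
have /sigma_finiteP[S [ST ndS mS]] := sigma_finiteT mu.
have mhn n : measurable [set x | h x <= n%:R%:E]%E.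
  by rewrite -[X in measurable X]setTI; exact: emeasurable_fun_infty_c.
exists (fun n => S n `&` [set x | h x <= n%:R%:E]%E); split.
- move=> n m nm x [Sx /= hx]; split; first exact: (subsetPset _ _ (ndS _ _ nm)).
  by rewrite /= (le_trans hx)// lee_fin ler_nat.
- by move=> n; apply: measurableI => //; exact: (mS n).1.
- move=> n; have [mSn Sfin] := mS n.
  rewrite hE; last exact: measurableI.
  apply: (@le_lt_trans _ _ (\int[mu]_(x in S n) n%:R%:E)%E).
    apply: (@le_trans _ _ (\int[mu]_(x in S n `&` [set x | h x <= n%:R%:E]) n%:R%:E)%E).
      apply: ge0_le_integral => //; first exact: measurableI.
        exact: measurable_funTS.
      by move=> x [].
    by apply: ge0_subset_integral => //; exact: measurableI.
  by rewrite integral_cst// lte_mul_pinfty.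
- apply: filterS hfin => x hx.
  have [N _ SNx] : (\bigcup_i S i) x by rewrite -ST.
  exists (maxn N (Num.truncn (fine (h x))).+1); split.
    by apply: (subsetPset _ _ (ndS _ _ _)) SNx; exact: leq_maxl.
  have hx_fin : h x \is a fin_num by rewrite ge0_fin_numE.
  rewrite /= -(fineK hx_fin) lee_fin.
  apply: (@le_trans _ _ (Num.truncn (fine (h x))).+1%:R).
    by rewrite ltW// truncnS_gt.
  by rewrite ler_nat leq_maxr.
Qed.

Variable mu : {measure set X -> \bar R}.

(** Pushing the measure with density |u|^2 forward along psi gives the measure with density h; F is
    integrated against both. *)
Lemma RN_change_of_variables (psi : X -> X) (u : X -> R[i]) (h F : X -> \bar R) :
  cmeasurable u -> measurable_fun setT psi -> is_RN_derivative mu psi u h ->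
  measurable_fun setT F -> (forall x, 0 <= F x)%E ->
  (\int[mu]_x (F (psi x) * (cmod (u x) ^+ 2)%:E) = \int[mu]_x (F x * h x))%E.
Proof.
move=> mu_ mpsi [mh h0 hE] mF F0.
have u0 x : (0 <= (cmod (u x) ^+ 2)%:E)%E by rewrite lee_fin sqr_ge0.
rewrite -(ge0_integral_density mu (measurable_cmod_sqr mu_) u0); first last.
- by move=> x; exact: F0.
- exact: measurableT_comp mF mpsi.
rewrite -(ge0_integral_density mu mh h0)//.
transitivity (\int[pushforward
    (density_measure mu (measurable_cmod_sqr mu_) u0) psi]_x F x)%E.
  by rewrite ge0_integral_pushforward.
by apply: eq_measure_integral => A mA _; exact: hE.
Qed.

(** Since |w^[2]|^2 = |w|^2 (|w|^2 o phi), this is the change of variables for F equal to |w|^2 on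
    phi^-1(A) and 0 elsewhere. It identifies the term |w|^2 h in the bound for w_alpha. *)
Lemma weighted_measure_iter2 (phi : X -> X) (w : X -> R[i]) (h : X -> \bar R)
    (A : set X) :
  cmeasurable w -> measurable_fun setT phi -> is_RN_derivative mu phi w h ->
  measurable A ->
  weighted_measure mu (weight_iter phi w 2) (iter 2 phi @^-1` A) =
  (\int[mu]_(x in phi @^-1` A) ((cmod (w x) ^+ 2)%:E * h x))%E.
Proof.
move=> mw mphi RNh mA.
have mpA : measurable (phi @^-1` A) by rewrite -[X in measurable X]setTI; exact: mphi.
pose F := (fun x => (cmod (w x) ^+ 2)%:E) \_ (phi @^-1` A).
have mF : measurable_fun setT F.
  by apply/(measurable_restrictT _ mpA)/measurable_funTS/measurable_cmod_sqr.
have F0 x : (0 <= F x)%E.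
  by rewrite /F patchE; case: ifP => // _; rewrite lee_fin sqr_ge0.
transitivity (\int[mu]_x (F x * h x))%E; last first.
  rewrite [RHS]integral_mkcond; apply: eq_integral => x _; rewrite /F !patchE.
  by case: ifP; rewrite ?mul0e.
rewrite -(RN_change_of_variables mw mphi RNh mF F0) /weighted_measure integral_mkcond.
apply: eq_integral => x _; rewrite /F !patchE.
rewrite (_ : (phi x \in phi @^-1` A) = (x \in iter 2 phi @^-1` A)); last by [].
case: ifP => _; last by rewrite mul0e.
by rewrite /weight_iter big_ord_recr big_ord1/= cmodM exprMn mulrC EFinM.
Qed.

End RadonNikodym.

(** * Descent of sigma-finiteness along the iterates of phi *)

Section Iterates.
Context {d : measure_display} {X : measurableType d} {R : realType}.
Variables (mu : {measure set X -> \bar R}) (phi : X -> X) (w : X -> R[i]).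
Hypotheses (mw : cmeasurable w) (mphi : measurable_fun setT phi).
Hypothesis acw : wco_abs_cont mu phi w.
Hypothesis w_neq0 : \forall x \ae mu, w x != 0.

Let nu k := pushforward (weighted_measure mu (weight_iter phi w k)) (iter k phi).

(** One has w^[k+1] = w^[k] (w o phi^k), and n |w o phi^k|^2 >= 1 wherever phi^k lands in the n-th
    new set; hence |w^[k]|^2 <= n |w^[k+1]|^2 there. *)
Lemma ae_sigma_finite_iterS k :
  ae_sigma_finite mu (nu k.+1) -> ae_sigma_finite mu (nu k).
Proof.
move=> [A [ndA mA Afin covA]].
have mwn (n : nat) : measurable [set x | 1 <= n%:R%:E * (cmod (w x) ^+ 2)%:E]%E.
  rewrite -[X in measurable X]setTI; apply: emeasurable_fun_c_infty => //.
  by apply: measurable_funeM; exact: measurable_cmod_sqr.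
have mpA n : measurable (phi @^-1` A n).
  by rewrite -[X in measurable X]setTI; exact: mphi.
exists (fun n => phi @^-1` A n `&`
    [set x | 1 <= n%:R%:E * (cmod (w x) ^+ 2)%:E]%E); split.
- move=> n m nm x [/= /(ndA _ _ nm) Ax wx]; split => //=.
  by rewrite (le_trans wx)// lee_wpmul2r ?lee_fin ?sqr_ge0 ?ler_nat.
- by move=> n; exact: measurableI.
- move=> n; apply: (@le_lt_trans _ _ (n%:R%:E * nu k.+1 (A n))%E); last first.
    by rewrite lte_mul_pinfty ?lee_fin.
  have miter j B : measurable B -> measurable (iter j phi @^-1` B).
    by move=> mB; rewrite -[X in measurable X]setTI; exact: measurable_fun_iter.
  apply: le_weighted_measure => //.
  + exact: cmeasurable_weight_iter.
  + exact: cmeasurable_weight_iter.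
  + by apply: miter; exact: measurableI.
  + exact: miter.
  + by move=> x [].
  + move=> x [_ /=]; rewrite -EFinM lee_fin => wx.
    rewrite /weight_iter big_ord_recr/= cmodM exprMn mulrCA ler_peMr//.
    exact: sqr_ge0.
(* The sets [A n] miss only a null set, whose preimage under phi is again null. *)
- have := ae_preimage mw mphi acw w_neq0 covA.
  move: w_neq0; apply: filterS2 => x wx [n /= Ax].
  have w2_gt0 : 0 < cmod (w x) ^+ 2 by rewrite exprn_even_gt0//= cmod_eq0.
  (* Any n above |w x|^(-2) gives n |w x|^2 >= 1. *)
  exists (maxn n (Num.truncn (cmod (w x) ^+ 2)^-1).+1); split => /=.
    by apply: ndA Ax; exact: leq_maxl.
  rewrite -EFinM lee_fin -ler_pdivrMr// div1r.
  apply: (@le_trans _ _ (Num.truncn (cmod (w x) ^+ 2)^-1).+1%:R).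
    by rewrite ltW// truncnS_gt.
  by rewrite ler_nat leq_maxr.
Qed.

Lemma ae_sigma_finite_iter j k : (j <= k)%N ->
  ae_sigma_finite mu (nu k) -> ae_sigma_finite mu (nu j).
Proof.
move=> /subnK <-; elim: (k - j)%N => [//|n IHn].
by rewrite addSn => /ae_sigma_finite_iterS.
Qed.

End Iterates.

(** * Elementary bounds for real powers *)

(** The square is t^alpha, which is at most 1 for t <= 1 and at most t for t > 1, because 0 < alpha
    <= 1. *)
Lemma powR_half_sqr_le (R : realType) (alpha t : R) : 0 < alpha <= 1 -> 0 <= t ->
  (t `^ (alpha / 2)) ^+ 2 <= 1 + t.
Proof.
move=> /andP[a0 a1] t0.
rewrite -powR_mulrn ?powR_ge0// -powRrM divfK//.
have [t1|t1] := leP t 1.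
  apply: (@le_trans _ _ 1); last by rewrite lerDl.
  have <- : 1 `^ alpha = 1 :> R by rewrite powR1.
  by rewrite ge0_ler_powR ?nnegrE// ltW.
apply: (@le_trans _ _ t); last by rewrite lerDr.
by rewrite -[leRHS]powRr1// ler_powR// ltW.
Qed.

(* A vanishing b is harmless because a / 0 = 0. *)
Lemma powR_ratio_half_sqr_le (R : realType) (alpha a b : R) (n : nat) :
  0 < alpha <= 1 -> 0 <= a -> 0 <= b ->
  b <= 0 \/ 1 <= n%:R * b -> ((a / b) `^ (alpha / 2)) ^+ 2 <= 1 + n%:R * a.
Proof.
move=> alpha01 a0 b0 [b_le0|nb].
  have -> : b = 0 by apply/eqP; rewrite eq_le b_le0.
  have /andP[al0 _] := alpha01.
  rewrite invr0 mulr0 powR0 ?expr0n ?addr_ge0 ?mulr_ge0//.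
  by rewrite mulf_neq0 ?gt_eqF.
have b_gt0 : 0 < b.
  by rewrite lt0r b0 andbT; apply/eqP => b_eq0; move: nb; rewrite b_eq0 mulr0 ler10.
apply: le_trans (powR_half_sqr_le alpha01 (divr_ge0 a0 b0)) _.
(* From 1 <= n b follows a / b <= n a. *)
by rewrite lerD2l ler_pdivrMr// mulrAC ler_peMl.
Qed.

(** * The weight w_alpha *)

Section WeightAlpha.
Context {d : measure_display} {X : measurableType d} {R : realType}.
Variables (mu : {measure set X -> \bar R}) (phi : X -> X) (w : X -> R[i]).
Variables (h : X -> \bar R) (alpha : R) (wa : X -> R[i]).
Hypotheses (mw : cmeasurable w) (mphi : measurable_fun setT phi).
Hypotheses (acw : wco_abs_cont mu phi w) (RNh : is_RN_derivative mu phi w h).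
Hypothesis alpha01 : 0 < alpha <= 1.
Hypothesis w_neq0 : \forall x \ae mu, w x != 0.
Hypothesis wa_alpha : is_weight_alpha mu phi w h alpha wa.

(** Preimages of null sets under phi are null for mu itself, hence for any measurable weight. *)
Lemma wco_abs_cont_weight_alpha : wco_abs_cont mu phi wa.
Proof.
have [mwa _] := wa_alpha.
apply: wco_abs_contP => A mA A0.
have mpA : measurable (phi @^-1` A) by rewrite -[X in measurable X]setTI; exact: mphi.
have nA : \forall x \ae mu, (~` A) x.
  by exists A; split => // x /= /contrapT.
transitivity (\int[mu]_(x in phi @^-1` A) `|(cmod (wa x) ^+ 2)%:E|)%E.
  by apply: eq_integral => x _; rewrite gee0_abs// lee_fin sqr_ge0.
apply/ae_eq_integral_abs => //; first exact/measurable_funTS/measurable_cmod_sqr.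
by apply: filterS (ae_preimage mw mphi acw w_neq0 nA) => x /= nAx /nAx.
Qed.

Lemma ae_sigma_finite_weight_alpha :
  ae_sigma_finite mu (pushforward (weighted_measure mu w) phi) ->
  ae_sigma_finite mu
    (pushforward (weighted_measure mu (weight_iter phi w 2)) (iter 2 phi)) ->
  ae_sigma_finite mu (pushforward (weighted_measure mu wa) phi).
Proof.
move=> [A [ndA mA Afin covA]] [D [ndD mD Dfin covD]].
have [mwa waE] := wa_alpha; have [mh h0 _] := RNh.
have mfh : measurable_fun setT (fun x => fine (h x)).
  exact: measurableT_comp mh.
(* As [fine] sends +oo to 0, the first set collects the points where h is 0 or +oo. If phi x lies
   there, the quotient defining w_alpha is a division by zero, hence 0, and the bound still holds;
   so the [E n] cover all of X. *)
pose E (n : nat) := [set x | fine (h x) <= 0] `|` [set x | 1 <= n%:R * fine (h x)].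
have mE n : measurable (E n).
  apply: measurableU; rewrite -[X in measurable X]setTI.
    exact: measurable_fun_le.
  by apply: measurable_fun_le => //; exact: measurable_funM.
pose B n := (A n `&` D n) `&` E n.
have mB n : measurable (B n) by apply: measurableI => //; exact: measurableI.
exists B; split => //.
- move=> n m nm x [[Ax Dx] Ex]; split; first by split; [exact: ndA Ax|exact: ndD Dx].
  case: Ex => /= hx; [by left|right => /=].
  by rewrite (le_trans hx)// ler_wpM2r ?ler_nat// fine_ge0.
- move=> n; have mphi_inv C : measurable C -> measurable (phi @^-1` C).
    by move=> mC; rewrite -[X in measurable X]setTI; exact: mphi.
  have mw2 S : measurable_fun S (fun x => (cmod (w x) ^+ 2)%:E).
    exact/measurable_funTS/measurable_cmod_sqr.
  have mw2h S : measurable_fun S (fun x => (cmod (w x) ^+ 2)%:E * h x)%E.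
    by apply: emeasurable_funM => //; exact: measurable_funTS.
  have w2_ge0 x : (0 <= (cmod (w x) ^+ 2)%:E)%E by rewrite lee_fin sqr_ge0.
  have w2h_ge0 x : (0 <= (cmod (w x) ^+ 2)%:E * h x)%E by rewrite mule_ge0.
  apply: (@le_lt_trans _ _ (\int[mu]_(x in phi @^-1` B n)
    ((cmod (w x) ^+ 2)%:E + n%:R%:E * ((cmod (w x) ^+ 2)%:E * h x)))%E).
    apply: ae_ge0_le_integral => //.
    + exact: mphi_inv.
    + by move=> x _; rewrite lee_fin sqr_ge0.
    + exact/measurable_funTS/measurable_cmod_sqr.
    + by move=> x _; rewrite adde_ge0// mule_ge0.
    + by apply: emeasurable_funD => //; exact: measurable_funeM.
    apply: filterS waE => x -> [_ /= Ex].
    rewrite cmodM exprMn cmod_real_sqr.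
    apply: (@le_trans _ _ ((cmod (w x) ^+ 2)%:E +
        n%:R%:E * ((cmod (w x) ^+ 2)%:E * (fine (h x))%:E))%E).
      rewrite -!EFinM -EFinD lee_fin.
      have -> : cmod (w x) ^+ 2 + n%:R * (cmod (w x) ^+ 2 * fine (h x)) =
          cmod (w x) ^+ 2 * (1 + n%:R * fine (h x)) by ring.
      by rewrite ler_wpM2l ?sqr_ge0// powR_ratio_half_sqr_le ?fine_ge0.
    (* [fine (h x) <= h x] also holds when h x = +oo. *)
    rewrite leeD2l// lee_wpmul2l// lee_wpmul2l//.
    by case: (h x) (h0 x) => //= _; rewrite leey.
  rewrite ge0_integralD//; first last.
  + by apply: measurable_funeM.
  + by move=> x _; rewrite mule_ge0.
  + exact: mphi_inv.
  rewrite ge0_integralZl//; last exact: mphi_inv.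
  rewrite lte_add_pinfty//.
    apply: le_lt_trans (Afin n); apply: ge0_subset_integral => //.
    + exact: mphi_inv.
    + exact: mphi_inv.
    + by move=> x [[]].
  rewrite lte_mul_pinfty ?lee_fin//; apply: le_lt_trans (Dfin n).
  rewrite /pushforward (weighted_measure_iter2 mw mphi RNh (mD n)).
  apply: ge0_subset_integral => //.
  + exact: mphi_inv.
  + exact: mphi_inv.
  + by move=> x [[]].
- move: covA; apply: filterS2 covD => x [n Dx] [m Ax].
  pose p := (Num.truncn (fine (h x))^-1).+1.
  (* The index [p] exceeds 1 / h x when h x is positive and finite; [m] and [n] serve [A] and
     [D]. *)
  exists (maxn (maxn m n) p); split.
    split; first by apply: ndA Ax; rewrite -maxnA leq_maxl.
    by apply: ndD Dx; rewrite maxnAC leq_maxr.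
  have [hx0|hx0] := leP (fine (h x)) 0; [by left|right => /=].
  rewrite -ler_pdivrMr// div1r; apply: (@le_trans _ _ p%:R).
    by rewrite ltW// truncnS_gt.
  by rewrite ler_nat leq_maxr.
Qed.

End WeightAlpha.

(** The first conjunct is included because w_alpha presupposes that C_{phi,w} is densely defined;
    [wa] ranges over all versions of w_alpha, which is determined only almost everywhere. *)
Theorem corollary15 (R : realType) (d : measure_display)
    (X : measurableType d) (mu : {sigma_finite_measure set X -> \bar R})
    (w : X -> R[i]) (phi : X -> X) (alpha : R) (h : X -> \bar R)
    (k : nat) (hk : X -> \bar R) :
  cmeasurable w ->
  measurable_fun [set: X] phi ->
  wco_abs_cont mu phi w ->
  is_RN_derivative mu phi w h ->
  0 < alpha <= 1 ->
  (\forall x \ae mu, w x != 0) ->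
  (2 <= k)%N ->
  is_RN_derivative mu (iter k phi) (weight_iter phi w k) hk ->
  (\forall x \ae mu, (hk x < +oo)%E) ->
  wco_densely_defined mu phi w /\
  (forall wa : X -> R[i], is_weight_alpha mu phi w h alpha wa ->
    wco_densely_defined mu phi wa).
Proof.
move=> mw mphi acw RNh alpha01 w_neq0 k2 RNhk hk_fin.
have fink := RN_ae_sigma_finite RNhk hk_fin.
have fin2 := ae_sigma_finite_iter mw mphi acw w_neq0 k2 fink.
(* One more descent, from 2 to 1, where w^[1] = w. *)
have fin1 : ae_sigma_finite mu (pushforward (weighted_measure mu w) phi).
  have := ae_sigma_finite_iterS mw mphi acw w_neq0 fin2.
  congr (ae_sigma_finite mu (pushforward (weighted_measure mu _) _)).
  by apply/funext => x; rewrite /weight_iter big_ord1.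
split; first exact: ae_sigma_finite_densely_defined.
move=> wa wa_alpha; have [mwa _] := wa_alpha.
apply: ae_sigma_finite_densely_defined => //.
  exact: wco_abs_cont_weight_alpha wa_alpha.
exact: ae_sigma_finite_weight_alpha wa_alpha fin1 fin2.
Qed.
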